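(* Let $X$ be a finite-dimensional real Hilbert space and let $A:X\rightrightarrows X$ and $B:X\rightrightarrows X$ be maximally monotone. Set $D':=\operatorname{dom}A-\operatorname{ran}B$ and $R':=\operatorname{ran}A+\operatorname{dom}B$. Let $T_{(A,B)}$ be the Douglas--Rachford operator of $(A,B)$. Suppose that $A$ and $B$ satisfy one of the following: (i) for every $w\in\operatorname{ri}D'\cap\operatorname{ri}R'$, $\operatorname{ri}(\operatorname{ran}A+\operatorname{dom}B)\subseteq\operatorname{ri}\operatorname{ran}(A+(B^{-1})_w)$, where $(B^{-1})_w:x\mapsto B^{-1}(x-w)$; (ii) $A$ and $B$ are $3^*$ monotone; (iii) $\operatorname{ran}B+(\operatorname{ri}D'\cap\operatorname{ri}R')\subseteq\operatorname{dom}A$ and $A$ is $3^*$ monotone. Then $$\operatorname{ran}T_{(A,B)}\simeq(\operatorname{dom}A-\operatorname{ran}B)\cap(\operatorname{ran}A+\operatorname{dom}B).$$ Furthermore, the following implications hold: (a) if there exists $C\in\{A,B^{-1}\}$ such that $\operatorname{dom}C=X$ and $C$ is $3^*$ monotone, then $\operatorname{ran}T_{(A,B)}\simeq\operatorname{ran}A+\operatorname{dom}B$; (b) if $\operatorname{ri}(D'\cap R')=D'\cap R'$, then $\operatorname{ran}T_{(A,B)}=(\operatorname{dom}A-\operatorname{ran}B)\cap(\operatorname{ran}A+\operatorname{dom}B)$.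
   Context: For a maximally monotone operator $A$ on $X$, the resolvent is $J_A=(\mathrm{Id}+A)^{-1}$ (single-valued with full domain) and the reflected resolvent is $R_A=2J_A-\mathrm{Id}$. The Douglas--Rachford operator of the ordered pair $(A,B)$ is $T_{(A,B)}:=\tfrac12\mathrm{Id}+\tfrac12R_BR_A=\mathrm{Id}-J_A+J_BR_A$. A monotone operator $A:X\rightrightarrows X$ is $3^*$ monotone (rectangular) if for all $x\in\operatorname{dom}A$ and $v\in\operatorname{ran}A$, $\inf_{(z,w)\in\operatorname{gra}A}\langle x-z,v-w\rangle>-\infty$. For $S\subseteq X$, $\operatorname{ri}S$ is the interior of $S$ relative to its affine hull. Near equality of two subsets $S_1,S_2$ of $X$: $S_1\simeq S_2$ means $\overline{S_1}=\overline{S_2}$ and $\operatorname{ri}S_1=\operatorname{ri}S_2$. Sums and differences of sets are Minkowski sums and differences. *)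

(* Defs.v *)
From HB Require Import structures.
From mathcomp Require Import all_boot all_order all_algebra.
From mathcomp Require Import all_classical all_reals all_analysis.
Set Implicit Arguments.
Unset Strict Implicit.
Unset Printing Implicit Defensive.
Import Order.TTheory GRing.Theory Num.Theory numFieldNormedType.Exports.
Local Open Scope classical_set_scope.
Local Open Scope ring_scope.

(** A finite-dimensional real Hilbert space is a normed space over [R] together
    with an inner product [dot] that induces the norm, and with a finite
    spanning family.  Completeness is automatic in finite dimension. *)
Definition finite_dimensional (R : realType) (X : normedModType R) : Prop :=
  exists (n : nat) (e : 'I_n -> X),
    forall x : X, exists c : 'I_n -> R, x = \sum_(i < n) c i *: e i.

Definition induces_norm (R : realType) (X : normedModType R)
    (dot : {dot X for idfun}) : Prop :=
  forall x : X, dot x x = `|x| ^+ 2.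

Section Sets.
Variables (R : realType) (X : normedModType R).
Implicit Types S : set X.

Definition minkowski_add S1 S2 : set X := [set a + b | a in S1 & b in S2].

Definition minkowski_sub S1 S2 : set X := [set a - b | a in S1 & b in S2].

Definition affine_hull S : set X :=
  [set x | exists (n : nat) (s : 'I_n -> X) (c : 'I_n -> R),
    [/\ forall i, S (s i), \sum_(i < n) c i = 1
      & x = \sum_(i < n) c i *: s i]].

Definition ri S : set X :=
  [set x | S x /\ \forall y \near x, affine_hull S y -> S y].

Definition near_equal S1 S2 : Prop := closure S1 = closure S2 /\ ri S1 = ri S2.

End Sets.

Section Operators.
Variables (R : realType) (X : normedModType R).

(** A set-valued operator on [X] is a function [A : X -> set X]. *)
Implicit Types A B : X -> set X.

Definition gra A : set (X * X) := [set p | A p.1 p.2].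

Definition dom A : set X := [set x | A x !=set0].

Definition ran A : set X := [set u | exists x, A x u].

Definition op_inv A : X -> set X := fun u => [set x | A x u].

Definition op_id : X -> set X := fun x => [set x].

Definition op_add A B : X -> set X := fun x => minkowski_add (A x) (B x).

Definition op_shift A (w : X) : X -> set X := fun x => A (x - w).

(** For a maximally monotone [A] the set [op_inv (op_add op_id A) x] is a
    singleton, and [resolvent A x] is its unique element.  The default value of
    [xget] only matters for other operators. *)
Definition resolvent A : X -> X :=
  fun x => xget 0 (op_inv (op_add op_id A) x).

Definition reflected_resolvent A : X -> X := fun x => 2 *: resolvent A x - x.

Definition douglas_rachford A B : X -> X := fun x =>
  2^-1 *: x + 2^-1 *: reflected_resolvent B (reflected_resolvent A x).

Variable dot : {dot X for idfun}.

Definition monotone_op A : Prop :=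
  forall x y u v : X, A x u -> A y v -> 0 <= dot (x - y) (u - v).

Definition maximally_monotone A : Prop :=
  monotone_op A /\
  forall B, monotone_op B -> gra A `<=` gra B -> gra B = gra A.

Definition rectangular A : Prop :=
  monotone_op A /\
  forall x v : X, dom A x -> ran A v ->
    (-oo < ereal_inf [set (dot (x - p.1) (v - p.2))%:E | p in gra A])%E.

End Operators.

(* Main.v *)
Require Import Defs.
From HB Require Import structures.
From mathcomp Require Import all_boot all_order all_algebra.
From mathcomp Require Import all_classical all_reals all_analysis.
From mathcomp Require Import ring lra.
Set Implicit Arguments.
Unset Strict Implicit.
Unset Printing Implicit Defensive.
Import Order.TTheory GRing.Theory Num.Theory numFieldNormedType.Exports.
Local Open Scope classical_set_scope.
Local Open Scope ring_scope.

(** A value of the Douglas--Rachford operator [T] is a vector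
    [a - b' = a' + b] with [(a, a')] in the graph of [A] and [(b, b')] in that of
    [B]; hence [ran T] is contained in [D' `&` R'].  The theorem follows from the
    converse inclusion [ri D' `&` ri R' `<=` ran T] and from near convexity.

    Near convexity.  [D'] and [R'] are both of the form [dom A - dom C] with [A]
    and [C] maximally monotone, and such a set contains the relative interior of
    its convex hull ([nearly_convex_dom_sub]).  So a segment from a relative
    interior point to a point of the set stays in the relative interior.
    Moreover [D' - R'] is the whole space, because [dom B + ran B] is, by Minty's
    theorem; therefore [ri D'] meets [ri R'] ([ri_meet]).  These two facts show
    that every set between [ri D' `&` ri R'] and [D' `&` R'] is nearly equal to
    [D' `&` R'], and that [ri (D' `&` R')] is contained in [ri D' `&` ri R']
    ([near_equal_sandwich], [ri_meet_sub]), which gives the main claim and (b).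
    Under the assumption of (a), [D'] is the whole space.

    The converse inclusion.  Under (i) it is immediate: a vector [w] in the range
    of [A + (B^-1)_w] is a value of [T].  Under (ii) and (iii), [T] is continuous
    and monotone, so [l *: x + T x = w] is solvable for every [l > 0]; if the
    solutions stay bounded as [l] decreases to 0, compactness gives [T x = w]
    ([solution_of_bounded_regularization]).  Splitting [x] as [a + a'], the
    monotonicity inequalities of [A] and [B] at graph points [(p, p')] and
    [(q, q')] bound [dot a' y1 + dot a y2] for [y1 = p - q' - w] and
    [y2 = p' + q - w] ([controlled_of_bound]).  Rectangularity makes it possible
    to have [y1 = 0] with [y2] arbitrary in [R' - w].  As [w] is a relative
    interior point, this bounds [a] in all directions of [R'], then [a'] in all
    directions of [D'], and [x] lies in the intersection of both spaces of
    directions.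

    The same regularization, applied to [z |-> J_C z - J_A (- z)], proves near
    convexity.  Minty's theorem and the solvability of the regularized equations
    both come from the Debrunner--Flor extension of monotone graphs
    ([debrunner_flor]), which in finite dimension reduces to maximizing a concave
    quadratic function on a simplex ([debrunner_flor_finite]). *)

(** * Inner products and compactness in finite dimension *)

Section InnerProduct.
Variables (R : realType) (X : normedModType R) (dot : {dot X for idfun}).
Hypothesis dot_norm : induces_norm dot.
Implicit Types (x y z u v : X) (a : R).

Lemma dotC x y : dot x y = dot y x.
Proof. by rewrite (hermC dot x y) expr0 mul1r. Qed.

Lemma dotDl x y z : dot (x + y) z = dot x z + dot y z.
Proof. exact: linearDl. Qed.
Lemma dotDr x y z : dot z (x + y) = dot z x + dot z y.
Proof. exact: linearDr. Qed.
Lemma dotNl x z : dot (- x) z = - dot x z.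
Proof. exact: linearNl. Qed.
Lemma dotNr x z : dot z (- x) = - dot z x.
Proof. exact: linearNr. Qed.
Lemma dotZl a x z : dot (a *: x) z = a * dot x z.
Proof. exact: linearZl_LR. Qed.
Lemma dotZr a x z : dot z (a *: x) = a * dot z x.
Proof. exact: linearZr_LR. Qed.
Lemma dot0l z : dot 0 z = 0.
Proof. exact: linear0l. Qed.
Lemma dot0r z : dot z 0 = 0.
Proof. exact: linear0r. Qed.

Definition dotE := (dotDl, dotDr, dotNl, dotNr, dotZl, dotZr, dot0l, dot0r).

Lemma dot_suml I (r : seq I) (F : I -> X) z :
  dot (\sum_(i <- r) F i) z = \sum_(i <- r) dot (F i) z.
Proof. exact: linear_sumlz. Qed.

Lemma dot_ge0 x : 0 <= dot x x.
Proof. by rewrite dot_norm sqr_ge0. Qed.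

Lemma dot_eq0 x : dot x x = 0 -> x = 0.
Proof. by rewrite dot_norm => /eqP; rewrite sqrf_eq0 normr_eq0 => /eqP. Qed.

Lemma dot_young x y : dot x y - dot x x <= dot y y.
Proof.
have := dot_ge0 (x - y); have := dot_ge0 x; have := dot_ge0 y.
rewrite !dotE (dotC y x); lra.
Qed.

Lemma dot_cauchy_schwarz x y : `|dot x y| <= `|x| * `|y|.
Proof.
rewrite -(@ler_pXn2r _ 2) ?nnegrE ?mulr_ge0// real_normK ?num_real// exprMn.
rewrite -!dot_norm; have [->|x0] := eqVneq x 0; first by rewrite !dotE expr0n mul0r.
have x1 : 0 < dot x x.
  by rewrite lt_neqAle dot_ge0 andbT eq_sym; apply/eqP => /dot_eq0/eqP; apply/negP.
have := dot_ge0 (dot x x *: y - dot x y *: x).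
rewrite !dotE (dotC y x) => h; rewrite -subr_ge0 -(pmulr_rge0 _ x1).
by apply: le_trans h _; rewrite le_eqVlt; apply/orP; left; apply/eqP; ring.
Qed.

Definition linear_subspace (V : set X) : Prop :=
  V 0 /\ forall x y a, V x -> V y -> V (a *: x + y).

Definition orthonormal_family m (f : 'I_m -> X) : Prop :=
  forall i j, dot (f i) (f j) = (i == j)%:R.

Lemma orthonormal_norm m (f : 'I_m -> X) i :
  orthonormal_family f -> `|f i| = 1.
Proof.
move=> of_; have := of_ i i; rewrite eqxx dot_norm => /eqP.
rewrite sqrf_eq1 => /orP[/eqP//|/eqP h].
by have := normr_ge0 (f i); rewrite h ler0N1.
Qed.

(** One Gram--Schmidt step. *)
Lemma orthonormal_extend m (f : 'I_m -> X) (V : set X) v :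
  orthonormal_family f -> (forall i, V (f i)) -> V v ->
  linear_subspace V -> v != \sum_i dot v (f i) *: f i ->
  exists g : 'I_m.+1 -> X, orthonormal_family g /\ forall i, V (g i).
Proof.
move=> of_ fV Vv [V0 Vlin] nv; set p := \sum_i _ in nv.
have fp j : dot p (f j) = dot v (f j).
  rewrite dot_suml (bigD1 j)//= big1 => [|i ij].
    by rewrite dotZl of_ eqxx mulr1 addr0.
  by rewrite dotZl of_ (negbTE ij) mulr0.
have Vp : V (v - p).
  rewrite addrC /p -sumrN; apply: (big_rec (fun s => V (s + v))).
    by rewrite add0r.
  by move=> i x _ Vx; rewrite -addrA -scaleNr; apply: Vlin.
have rf j : dot (v - p) (f j) = 0 by rewrite !dotE fp subrr.
have r0 : `|v - p| != 0 by rewrite normr_eq0 subr_eq0.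
pose g (i : 'I_m.+1) :=
  if unlift ord0 i is Some j then f j else `|v - p|^-1 *: (v - p).
exists g; split; last first.
  move=> i; rewrite /g; case: unlift => // ; rewrite -[_ *: _]addr0; exact: Vlin.
move=> i j; rewrite /g; case: unliftP => [i' ->|->]; case: unliftP => [j' ->|->].
- by rewrite of_ (inj_eq lift_inj).
- by rewrite dotZr dotC rf mulr0 eq_sym eq_liftF.
- by rewrite dotZl rf mulr0 eq_liftF.
- by rewrite dotZl dotZr dot_norm eqxx expr2 mulrA -invfM mulVf// mulf_neq0.
Qed.

(** The Gram matrix of [f] is the identity and factors through the [n]
    coordinates on [e], so its rank is at most [n]. *)
Lemma orthonormal_leq n (e : 'I_n -> X) m (f : 'I_m -> X) :
  (forall x, exists c : 'I_n -> R, x = \sum_(i < n) c i *: e i) ->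
  orthonormal_family f -> (m <= n)%N.
Proof.
move=> espan of_; have [c cE] := choice (fun i => espan (f i)).
pose C := \matrix_(i < m, j < n) c i j.
pose D := \matrix_(j < n, k < m) dot (e j) (f k).
have CD : C *m D = 1%:M.
  apply/matrixP => i k; rewrite !mxE -of_ [in RHS](cE i) dot_suml.
  by apply: eq_bigr => j _; rewrite !mxE dotZl.
by rewrite -(mxrank1 R m) -CD (leq_trans (mxrankM_maxl _ _))// rank_leq_col.
Qed.

Hypothesis Xfin : finite_dimensional X.

(** An orthonormal family of maximal length in [V] spans [V], since otherwise
    it could be extended. *)
Lemma orthonormal_basis (V : set X) : linear_subspace V ->
  exists m (f : 'I_m -> X), [/\ orthonormal_family f, forall i, V (f i) &
    forall v, V v -> v = \sum_i dot v (f i) *: f i].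
Proof.
move=> Vlin; have [n [e espan]] := Xfin.
suff H k : forall m (f : 'I_m -> X), (m + k = n)%N ->
    orthonormal_family f -> (forall i, V (f i)) ->
  exists m (f : 'I_m -> X), [/\ orthonormal_family f, forall i, V (f i) &
    forall v, V v -> v = \sum_i dot v (f i) *: f i].
  by apply: (H n 0%N (fun=> 0)) => // -[].
elim: k => [|k IH] m f mk of_ fV.
  exists m, f; split=> // v Vv; apply/eqP/negPn/negP => nv.
  have [g [og _]] := orthonormal_extend of_ fV Vv Vlin nv.
  by have := orthonormal_leq espan og; rewrite -mk addn0 ltnn.
have [Vf|] := pselect (forall v, V v -> v = \sum_i dot v (f i) *: f i).
  by exists m, f.
move=> /existsNP[v] /not_implyP[Vv /eqP nv].
have [g [og gV]] := orthonormal_extend of_ fV Vv Vlin nv.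
by apply: (IH _ g); rewrite // addSnnS.
Qed.

Lemma coord_le_norm m (f : 'I_m -> X) x i :
  orthonormal_family f -> `|dot x (f i)| <= `|x|.
Proof.
move=> of_; rewrite (le_trans (dot_cauchy_schwarz _ _))//.
by rewrite (orthonormal_norm _ of_) mulr1.
Qed.

(** In coordinates, the ball is a closed part of the continuous image of a cube. *)
Lemma closed_ball_set_compact (r : R) : compact [set x : X | `|x| <= r].
Proof.
have [m [f [of_ _ fE]]] := @orthonormal_basis setT (conj I (fun _ _ _ _ _ => I)).
pose g (c : 'rV[R]_m) : X := \sum_i c ord0 i *: f i.
have gc : continuous g.
  move=> c; apply: (@cvg_big _ _ _ _ xpredT add_continuous _ (nbhs c)) => i _.
  by apply: cvgZr_tmp; exact: coord_continuous.
have cK : compact (g @` [set c : 'rV[R]_m | forall i, `[- r, r]%classic (c ord0 i)]).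
  apply: continuous_compact; first exact: continuous_subspaceT.
  by apply: (@rV_compact R m (fun=> `[- r, r]%classic)) => _; exact: segment_compact.
apply: (subclosed_compact _ cK).
  apply: (@closed_comp _ _ (fun x : X => `|x|) [set t | t <= r]) => [x _|].
    exact: norm_continuous.
  exact: closed_le.
move=> x /= xr; exists (\row_i dot x (f i)).
  move=> i /=; rewrite mxE in_itv/= -ler_norml.
  exact: le_trans (coord_le_norm x i of_) xr.
by rewrite /g [RHS](fE x I); apply: eq_bigr => i _; rewrite mxE.
Qed.

Lemma cvg_dot (T : Type) (F : set_system T) (FF : Filter F) (f g : T -> X) x y :
  f @ F --> x -> g @ F --> y -> (fun t => dot (f t) (g t)) @ F --> dot x y.
Proof.
have dotbE u v : dot u v = 2^-1 * (`|u + v| ^+ 2 - `|u| ^+ 2 - `|v| ^+ 2).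
  by rewrite -!dot_norm !dotE (dotC v u); field.
move=> fx gy; rewrite dotbE.
under eq_fun do rewrite dotbE.
apply: cvgMl_tmp; apply: cvgB; first apply: cvgB.
- by rewrite !expr2; apply: cvgM; apply: cvg_norm; apply: cvgD.
- by rewrite !expr2; apply: cvgM; apply: cvg_norm.
- by rewrite !expr2; apply: cvgM; apply: cvg_norm.
Qed.

End InnerProduct.

(** * Extension of monotone graphs *)

Section DebrunnerFlor.
Variables (R : realType) (X : normedModType R) (dot : {dot X for idfun}).
Hypothesis dot_norm : induces_norm dot.
Implicit Types (x y z u v w : X) (a t : R).

Lemma le0_of_le_small (b d : R) :
  (forall t, 0 < t -> t <= 1 -> b <= t * d) -> b <= 0.
Proof.
move=> h; rewrite leNgt; apply/negP => b0.
have d0 : 0 < d by have := h 1 ltr01 (lexx _); rewrite mul1r; apply: lt_le_trans.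
have bd : 0 < b + d by rewrite addr_gt0.
have := h (b / (b + d)) (divr_gt0 b0 bd).
rewrite ler_pdivrMr// mul1r lerDl (ltW d0) => /(_ isT).
by rewrite mulrAC ler_pdivlMr// ler_pM2l// gerDr leNgt b0.
Qed.

(** The hypothesis compares two values of a concave quadratic function of the
    parameter, at distance [t]; dividing by [t] bounds its slope. *)
Lemma quadratic_slope z y t s c : 0 < t ->
  - dot (z + t *: (y - z)) (z + t *: (y - z)) - ((1 - t) * s + t * c) <=
    - dot z z - s ->
  dot z z - 2 * dot z y - c - (- dot z z - s) <= t * dot (y - z) (y - z).
Proof.
move=> t0 h; rewrite -(ler_pM2l t0) -subr_ge0; move: h; rewrite -subr_ge0.
rewrite !dotE (dotC _ y z) => /le_trans; apply.
by rewrite le_eqVlt; apply/orP; left; apply/eqP; ring.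
Qed.

(** Let [z] be the barycentre of the vectors [(x i - u i) / 2] whose weights
    maximize [phi] over the simplex, where [phi l] is the minimum over [z] of the
    averaged constraints [sum_i l i * - dot (x i - z) (u i + z)].  Moving the
    weights towards the [i]-th vertex does not increase [phi], so the [i]-th
    constraint function at [z] is at most the maximum of [phi]; and [phi] is
    nonpositive because the points are pairwise monotonically related. *)
Lemma debrunner_flor_finite n (x u : 'I_n -> X) :
  (forall i j, 0 <= dot (x i - x j) (u i - u j)) ->
  exists z, forall i, 0 <= dot (x i - z) (u i + z).
Proof.
case: n x u => [|n] x u mono; first by exists 0 => -[].
pose g i := 2^-1 *: (x i - u i).
pose c i := dot (x i) (u i).
pose xl (l : 'rV[R]_n.+1) := \sum_i l ord0 i *: g i.
pose phi (l : 'rV[R]_n.+1) := - dot (xl l) (xl l) - \sum_i l ord0 i * c i.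
pose S := [set l : 'rV[R]_n.+1 | (forall i, `[0, 1]%classic (l ord0 i))] `&`
          [set l : 'rV[R]_n.+1 | \sum_i l ord0 i = 1].
have cS : compact S.
  apply: compact_closedI.
    by apply: (@rV_compact R n.+1 (fun=> `[0, 1]%classic)) => _; exact: segment_compact.
  apply: (@closed_comp _ _ (fun l : 'rV[R]_n.+1 => \sum_i l ord0 i) [set 1]).
    move=> l _; apply: (@cvg_big _ _ _ _ xpredT add_continuous _ (nbhs l)) => i _.
    exact: coord_continuous.
  exact: closed_eq.
have S0 : S !=set0.
  exists (\row_i (i == ord0)%:R); split => [i|] /=.
    by rewrite mxE in_itv/=; case: (i == ord0); rewrite ?lexx ?ler01.
  under eq_bigr do rewrite mxE.
  by rewrite (bigD1 ord0)//= big1 ?addr0// => i /negbTE->.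
have cphi : continuous phi.
  have cxl : continuous xl.
    move=> l; apply: (@cvg_big _ _ _ _ xpredT add_continuous _ (nbhs l)) => i _.
    by apply: cvgZr_tmp; exact: coord_continuous.
  move=> l; apply: (@cvgB _ _ _ (nbhs l)).
    by apply: (@cvgN _ _ _ (nbhs l)); apply: (cvg_dot dot_norm); exact: cxl.
  apply: (@cvg_big _ _ _ _ xpredT add_continuous _ (nbhs l)) => i _.
  by apply: cvgMr_tmp; exact: coord_continuous.
have [L] := compact_EVT_max S0 cS (continuous_subspaceT cphi).
rewrite inE => -[L01 L1] Lmax; pose z := xl L; exists z => i.
pose xb := \sum_i L ord0 i *: x i.
pose ub := \sum_i L ord0 i *: u i.
pose s := \sum_i L ord0 i * c i.
have sumx y : \sum_i L ord0 i * dot (x i) y = dot xb y.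
  by rewrite /xb dot_suml; apply: eq_bigr => j _; rewrite dotZl.
have sumu y : \sum_i L ord0 i * dot (u i) y = dot ub y.
  by rewrite /ub dot_suml; apply: eq_bigr => j _; rewrite dotZl.
have sumc a : \sum_i L ord0 i * a = a by rewrite -mulr_suml L1 mul1r.
have zE : z = 2^-1 *: (xb - ub).
  rewrite /z /xl /xb /ub -sumrB scaler_sumr; apply: eq_bigr => j _.
  by rewrite /g -scalerBr !scalerA mulrC.
have inner k : \sum_j L ord0 j * dot (x k - x j) (u k - u j) =
    c k - dot (x k) ub - dot xb (u k) + s.
  transitivity (\sum_j (L ord0 j * c k - L ord0 j * dot (u j) (x k)
      - L ord0 j * dot (x j) (u k) + L ord0 j * c j)).
    by apply: eq_bigr => j _; rewrite !dotE /c (dotC dot (u j)); ring.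
  by rewrite big_split/= !sumrB sumc sumu sumx (dotC _ ub).
(* averaging the monotonicity inequalities over all pairs of indices *)
have sxu : dot xb ub <= s.
  have : 0 <= \sum_k L ord0 k * \sum_j L ord0 j * dot (x k - x j) (u k - u j).
    apply: sumr_ge0 => k _; have := L01 k; rewrite /= in_itv/= => /andP[Lk _].
    apply: mulr_ge0 => //; apply: sumr_ge0 => j _.
    have := L01 j; rewrite /= in_itv/= => /andP[Lj _].
    by rewrite mulr_ge0.
  have -> : \sum_k L ord0 k * \sum_j L ord0 j * dot (x k - x j) (u k - u j) =
     \sum_k (L ord0 k * c k - L ord0 k * dot (x k) ub
       - L ord0 k * dot (u k) xb + L ord0 k * s).
    by apply: eq_bigr => k _; rewrite inner (dotC _ xb); ring.
  rewrite big_split/= !sumrB sumc sumu sumx (dotC _ ub) -/s; lra.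
(* completing the square: phi L <= - |xb + ub|^2 / 4 *)
have phi0 : phi L <= 0.
  have := dot_ge0 dot_norm (xb + ub).
  rewrite /phi -/z -/s zE !dotE (dotC _ ub xb); lra.
suff : dot z z - 2 * dot z (g i) - c i - phi L <= 0.
  rewrite /g /c !dotE (dotC _ z (x i)); lra.
apply: (@le0_of_le_small _ (dot (g i - z) (g i - z))) => t t0 t1.
pose L' := \row_j ((1 - t) * L ord0 j + t * (j == i)%:R).
have sumL' (V : lmodType R) (f : 'I_n.+1 -> V) : \sum_j L' ord0 j *: f j =
    (1 - t) *: \sum_j L ord0 j *: f j + t *: f i.
  rewrite scaler_sumr (bigD1 i)//= [in RHS](bigD1 i)//= -addrA [_ + t *: _]addrC addrA.
  rewrite mxE eqxx mulr1 scalerDl scalerA; congr (_ + _).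
  by apply: eq_bigr => j /negbTE ji; rewrite mxE ji mulr0 addr0 scalerA.
have SL' : S L'.
  split => [j|] /=.
    have := L01 j; rewrite /= !in_itv/= mxE => /andP[a0 a1].
    have ta0 : 0 <= (1 - t) * L ord0 j by rewrite mulr_ge0 ?subr_ge0.
    have ta1 : (1 - t) * L ord0 j <= 1 - t by rewrite ler_piMr ?subr_ge0.
    by case: (j == i); rewrite ?(mulr1, mulr0); apply/andP; split; lra.
  have := sumL' R^o (fun=> 1); rewrite /= /GRing.scale/= => h.
  have [e1 e2] : \sum_j L' ord0 j = \sum_j L' ord0 j * 1 /\
      \sum_j L ord0 j * 1 = 1 :> R.
    by split; [under [RHS]eq_bigr do rewrite mulr1|under eq_bigr do rewrite mulr1].
  by rewrite e1 h e2 !mulr1 subrK.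
have := Lmax L'; rewrite inE => /(_ SL').
have -> : phi L' = - dot (z + t *: (g i - z)) (z + t *: (g i - z))
     - ((1 - t) * s + t * c i).
  rewrite /phi; congr (- dot _ _ - _); last exact: (sumL' R^o c).
  - by rewrite /xl sumL' -/(xl L) -/z scalerBl scale1r scalerBr addrAC addrA.
  - by rewrite /xl sumL' -/(xl L) -/z scalerBl scale1r scalerBr addrAC addrA.
exact: quadratic_slope.
Qed.

Hypothesis Xfin : finite_dimensional X.

(** Each constraint defines a closed ball, so by compactness the finite case
    extends to arbitrary monotone graphs. *)
Lemma debrunner_flor (S : set (X * X)) w :
  (forall p q, S p -> S q -> 0 <= dot (p.1 - q.1) (p.2 - q.2)) ->
  exists z, forall p, S p -> 0 <= dot (p.1 - z) (p.2 + z - w).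
Proof.
move=> mono; have [[p0 Sp0]|S0] := pselect (S !=set0); last first.
  by exists 0 => p Sp; case: S0; exists p.
pose G p := [set z | 0 <= dot (p.1 - z) (p.2 + z - w)].
have clG p : closed (G p).
  apply: (@closed_comp _ _ (fun z => dot (p.1 - z) (p.2 + z - w)) [set t | 0 <= t]).
    move=> z _; apply: (cvg_dot dot_norm); first by apply: cvgB; [exact: cvg_cst|].
    by apply: cvgB; [apply: cvgD; [exact: cvg_cst|]|exact: cvg_cst].
  exact: closed_ge.
pose r := 4 * dot (p0.1 - p0.2 + w) (p0.1 - p0.2 + w) +
  2 * `|dot p0.1 (p0.2 - w)| + 1.
have Gr : G p0 `<=` [set z | `|z| <= r].
  move=> z; rewrite /G /= => h.
  have r1 : 1 <= r.
    by rewrite /r lerDr addr_ge0// mulr_ge0// dot_ge0.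
  rewrite -(@ler_pXn2r _ 2) ?nnegrE ?(le_trans ler01 r1)//; rewrite -dot_norm.
  suff zr : dot z z <= r.
    by apply: le_trans zr _; rewrite expr2 ler_peMr// (le_trans ler01).
  have := dot_young dot_norm (2^-1 *: z) (p0.1 - p0.2 + w).
  have := ler_norm (dot p0.1 (p0.2 - w)).
  move: h; rewrite /r !dotE.
  move: (`|_|) => N.
  rewrite !(dotC dot _ z) !(dotC dot p0.2 p0.1) !(dotC dot w p0.1) !(dotC dot w p0.2).
  lra.
have : compact [set z : X | `|z| <= r].
  exact: (closed_ball_set_compact dot_norm Xfin).
rewrite compact_In0 => /(_ (X * X)%type S (fun p => [set z | `|z| <= r] `&` G p)).
case.
- by exists G.
- move=> D' D'S.
  pose l := p0 :: finmap.enum_fset D'.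
  have lS i : (i < size l)%N -> S (nth p0 l i).
    move=> /(mem_nth p0); rewrite inE => /orP[/eqP->//|lD'].
    by have := D'S _ lD'; rewrite inE.
  have [i j|z hz] := @debrunner_flor_finite (size l) (fun i => (nth p0 l i).1)
     (fun i => (nth p0 l i).2 - w).
    by rewrite opprB [X in dot _ X]addrA subrK; apply: mono; exact: lS.
  have Gz p : p \in l -> G p z.
    move=> pl; have il := pl; rewrite -index_mem in il.
    have := hz (Ordinal il); rewrite /= nth_index// /G /=.
    by rewrite addrAC.
  exists z => p pD'; split; first by apply/Gr/Gz; rewrite mem_head.
  by apply: Gz; rewrite inE; apply/orP; right.
- by move=> z hz; exists z => p Sp; have [] := hz p Sp.
Qed.

End DebrunnerFlor.

(** * Equations with continuous monotone maps *)

Section MonotoneMaps.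
Variables (R : realType) (X : normedModType R) (dot : {dot X for idfun}).
Hypotheses (dot_norm : induces_norm dot) (Xfin : finite_dimensional X).
Implicit Types (x y z u v w : X) (F : X -> X).

Definition monotone_map F : Prop := forall x y, 0 <= dot (x - y) (F x - F y).

Lemma lipschitz1_continuous F :
  (forall x y, `|F x - F y| <= `|x - y|) -> continuous F.
Proof.
move=> lipF x; apply/cvgrPdist_lt => e e0; near=> y.
apply: le_lt_trans (lipF x y) _; near: y.
by apply/nbhs_ballP; exists e => //= y; rewrite -ball_normE.
Unshelve. all: by end_near. Qed.

(** The graph of [l^-1 *: F] admits a point [z] related to all of it; Minty's
    trick of testing at [z + t *: h] and letting [t] tend to 0 gives the equation. *)
Lemma regularized_solution F w (l : R) :
  continuous F -> monotone_map F -> 0 < l -> exists z, l *: z + F z = w.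
Proof.
move=> cF mF l0.
pose S := [set p : X * X | p.2 = l^-1 *: F p.1].
have [p q Sp Sq|z zS] := @debrunner_flor _ _ _ dot_norm Xfin S (l^-1 *: w).
  rewrite Sp Sq -scalerBr dotZr mulr_ge0 ?mF// invr_ge0 ltW//.
pose G p := l^-1 *: F p + z - l^-1 *: w.
have cG : continuous G.
  move=> p; apply: cvgB; last exact: cvg_cst.
  by apply: cvgD; [apply: cvgZl_tmp; exact: cF|exact: cvg_cst].
have Gh h : 0 <= dot h (G z).
  have /cvgr_to_ge : dot h (G (z + t *: h)) @[t --> 0^'+] --> dot h (G z).
    apply: cvg_at_right_filter; apply: (cvg_dot dot_norm); first exact: cvg_cst.
    have zth : z + t *: h @[t --> (0 : R)] --> z + 0 *: h.
      by apply: cvgD; [exact: cvg_cst|apply: cvgZr_tmp; exact: cvg_id].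
    rewrite scale0r addr0 in zth.
    by apply: (@cvg_comp _ _ _ (fun t => z + t *: h) G _ (nbhs z)) => //; exact: cG.
  apply; near=> t.
  have t0 : 0 < t by near: t; exact: nbhs_right_gt.
  have := zS (z + t *: h, l^-1 *: F (z + t *: h)) erefl.
  by rewrite /= addrAC subrr add0r dotZl pmulr_rge0.
have /(dot_eq0 dot_norm) Gz0 : dot (G z) (G z) = 0.
  apply/eqP; rewrite eq_le dot_ge0// andbT; have := Gh (- G z).
  by rewrite dotNl oppr_ge0.
exists z; apply/eqP; rewrite -subr_eq0.
have /eqP := congr1 ( *:%R l) Gz0.
by rewrite scaler0 scalerBr scalerDr !scalerA mulfV ?gt_eqF// !scale1r [F z + _]addrC.
Unshelve. all: by end_near. Qed.

(** Vanishing regularization: if the solutions of the perturbed equations stay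
    in a subspace on which they are bounded in each direction, they are bounded,
    and compactness turns the approximate solutions into an exact one. *)
Lemma solution_of_bounded_regularization F w (V : set X) :
  continuous F -> monotone_map F -> linear_subspace V ->
  (forall (l : R) z, 0 < l -> l <= 1 -> l *: z + F z = w -> V z) ->
  (forall v, V v -> exists K : R, forall (l : R) z, 0 < l -> l <= 1 ->
     l *: z + F z = w -> dot z v <= K) ->
  exists z, F z = w.
Proof.
move=> cF mF Vlin Vz Vbnd.
have [m [f [of_ fV fE]]] := orthonormal_basis dot_norm Xfin Vlin.
have fNV i : V (- f i) by rewrite -scaleN1r -[_ *: _]addr0; apply: Vlin.2 => //; exact: Vlin.1.
have [K KP] := choice (fun i => Vbnd _ (fV i)).
have [K' KP'] := choice (fun i => Vbnd _ (fNV i)).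
pose M := \sum_i (`|K i| + `|K' i|).
have M0 : 0 <= M by apply: sumr_ge0 => i _; rewrite addr_ge0.
have zM l z : 0 < l -> l <= 1 -> l *: z + F z = w -> `|z| <= M.
  move=> l0 l1 zE; rewrite (fE z (Vz _ _ l0 l1 zE)).
  apply: le_trans (ler_norm_sum _ _ _) _; apply: ler_sum => i _.
  rewrite normrZ (orthonormal_norm dot_norm _ of_) mulr1 ler_norml.
  have := KP i _ _ l0 l1 zE; have := KP' i _ _ l0 l1 zE; rewrite dotNr.
  have := ler_norm (K i); have := ler_norm (K' i).
  have := normr_ge0 (K i); have := normr_ge0 (K' i).
  move: (`|K i|) (`|K' i|) => N N' *; apply/andP; split; lra.
have cFB : closed (F @` [set z | `|z| <= M]).
  apply: compact_closed; first exact: norm_hausdorff.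
  apply: continuous_compact; first exact: continuous_subspaceT.
  exact: (closed_ball_set_compact dot_norm Xfin).
suff [z _ zw] : (F @` [set z | `|z| <= M]) w by exists z.
apply: cFB => B /nbhs_ballP[e /= e0 eB].
pose l := Num.min 1 (e / (M + 1)).
have M1 : 0 < M + 1 by rewrite ltr_wpDl.
have l0 : 0 < l by rewrite lt_min ltr01 divr_gt0.
have l1 : l <= 1 by rewrite ge_min lexx.
have [z zE] := regularized_solution w cF mF l0.
exists (F z); split; first by exists z => //; exact: zM zE.
apply: eB; rewrite -ball_normE /= -zE addrK normrZ gtr0_norm//.
have : l <= e / (M + 1) by rewrite ge_min lexx orbT.
rewrite ler_pdivlMr//; have := zM _ _ l0 l1 zE; move: (`|z|) => N NM.
by move=> /lt_le_trans; apply; rewrite ltr_pM2l// ltr_pwDr.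
Qed.

End MonotoneMaps.

(** * Minty's theorem and resolvents *)

Section Resolvents.
Variables (R : realType) (X : normedModType R) (dot : {dot X for idfun}).
Hypotheses (dot_norm : induces_norm dot) (Xfin : finite_dimensional X).
Implicit Types (x y z u v w : X) (A B C : X -> set X).

Lemma maximally_monotone_mem A x u : maximally_monotone dot A ->
  (forall y v, A y v -> 0 <= dot (y - x) (v - u)) -> A x u.
Proof.
move=> [mA maxA] xu; pose B y := [set v | A y v \/ (y = x /\ v = u)].
have mB : monotone_op dot B.
  move=> y z v v' [Ay|[-> ->]] [Az|[-> ->]]; first exact: mA.
  - exact: xu.
  - by rewrite -(opprB z) -(opprB v') dotNl dotNr opprK xu.
  - by rewrite !subrr dot0l.
have AB : gra A `<=` gra B by move=> p Ap; left.
have : gra B (x, u) by right.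
by rewrite (maxA B mB AB).
Qed.

Lemma maximally_monotone_inv A :
  maximally_monotone dot A -> maximally_monotone dot (op_inv A).
Proof.
move=> [mA maxA]; split=> [x y u v Ax Ay|B mB AB].
  by rewrite dotC; exact: mA.
have mB' : monotone_op dot (op_inv B).
  by move=> x y u v Bx By; rewrite dotC; exact: mB.
have AB' : gra A `<=` gra (op_inv B) by move=> [x u] Axu; exact: (AB (u, x)).
apply/seteqP; split=> [[u x] Bux|//].
by have : gra (op_inv B) (x, u) by []; rewrite (maxA _ mB' AB').
Qed.

(** Together with inversion, this turns statements on sums of ranges and domains
    into statements on differences of domains. *)
Lemma maximally_monotone_opp A : maximally_monotone dot A ->
  maximally_monotone dot (fun x => [set u | A (- x) (- u)]).
Proof.
move=> [mA maxA]; split=> [x y u v Ax Ay|B mB AB].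
  by have := mA _ _ _ _ Ax Ay; rewrite -!opprD dotNl dotNr opprK.
pose B' x := [set u | B (- x) (- u)].
have mB' : monotone_op dot B'.
  by move=> x y u v Bx By; have := mB _ _ _ _ Bx By; rewrite -!opprD dotNl dotNr opprK.
have AB' : gra A `<=` gra B'.
  by move=> [x u] Axu; apply: (AB (- x, - u)); rewrite /gra /= !opprK.
apply/seteqP; split=> [[u x] Bux|//].
have : gra B' (- u, - x) by rewrite /gra /B' /= !opprK.
by rewrite (maxA _ mB' AB').
Qed.

Lemma minty A w : maximally_monotone dot A -> exists z, A z (w - z).
Proof.
move=> Amax.
have [p q Sp Sq|z zS] := @debrunner_flor _ _ _ dot_norm Xfin (gra A) w.
  exact: Amax.1.
exists z; apply: (maximally_monotone_mem Amax) => y v Ayv.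
by rewrite opprB addrA; exact: (zS (y, v)).
Qed.

Lemma resolventP A x : maximally_monotone dot A ->
  A (resolvent A x) (x - resolvent A x).
Proof.
move=> Amax; rewrite /resolvent; set J := xget _ _.
have [] : op_inv (op_add (@op_id R X) A) x J.
  apply: xgetPex; have [z Az] := minty x Amax; exists z.
  by exists z => //; exists (x - z) => //; rewrite addrC subrK.
by move=> _ -> [u Au <-]; rewrite addrC addKr.
Qed.

Lemma resolvent_firm A x y : maximally_monotone dot A ->
  dot (resolvent A x - resolvent A y) (resolvent A x - resolvent A y) <=
  dot (resolvent A x - resolvent A y) (x - y).
Proof.
move=> Amax; set d := resolvent A x - _.
have := Amax.1 _ _ _ _ (resolventP x Amax) (resolventP y Amax).
have -> : x - resolvent A x - (y - resolvent A y) = x - y - d.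
  by rewrite /d !opprD !opprK addrACA.
by rewrite -/d dotDr dotNr subr_ge0.
Qed.

Lemma resolvent_unique A x a : maximally_monotone dot A ->
  A a (x - a) -> resolvent A x = a.
Proof.
move=> Amax Aa; apply/eqP; rewrite -subr_eq0; apply/eqP; apply: (dot_eq0 dot_norm).
apply/eqP; rewrite eq_le dot_ge0// andbT.
have := Amax.1 _ _ _ _ (resolventP x Amax) Aa.
rewrite opprB [_ + (a - x)]addrC addrA subrK => h.
by rewrite -oppr_ge0 -dotNr opprB.
Qed.

Lemma resolvent_continuous A :
  maximally_monotone dot A -> continuous (resolvent A).
Proof.
move=> Amax; apply: lipschitz1_continuous => x y.
have [->|d0] := eqVneq (`|resolvent A x - resolvent A y|) 0; first exact: normr_ge0.
have dp : 0 < `|resolvent A x - resolvent A y| by rewrite lt_neqAle eq_sym d0 normr_ge0.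
rewrite -(ler_pM2l dp) -expr2 -dot_norm.
apply: le_trans (resolvent_firm x y Amax) _.
exact: le_trans (ler_norm _) (dot_cauchy_schwarz dot_norm _ _).
Qed.

Lemma gra_nonempty A : maximally_monotone dot A -> exists x u, A x u.
Proof. by move=> /(minty 0)[z Az]; exists z, (0 - z). Qed.

End Resolvents.

(** * Convex sets and relative interiors *)

Section AffineGeometry.
Variables (R : realType) (X : normedModType R).
Implicit Types (x y z u v w : X) (a t : R) (S K : set X).

(** Combinations with arbitrary total weight [a] make the affine hull, the case
    of total weight 1, accessible to linear manipulations. *)
Definition combination S a : set X :=
  [set x | exists (n : nat) (s : 'I_n -> X) (c : 'I_n -> R),
    [/\ forall i, S (s i), \sum_(i < n) c i = a
      & x = \sum_(i < n) c i *: s i]].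

Lemma combinationD S a b x y :
  combination S a x -> combination S b y -> combination S (a + b) (x + y).
Proof.
move=> [n [s [c [Ss <- ->]]]] [m [s' [c' [Ss' <- ->]]]].
exists (n + m)%N, (fun i : 'I_(n + m) => match fintype.split i with inl j => s j | inr j => s' j end).
exists (fun i : 'I_(n + m) => match fintype.split i with inl j => c j | inr j => c' j end).
split.
- by move=> i; case: fintype.split.
- rewrite big_split_ord/=; congr (_ + _); apply: eq_bigr => i _.
  + by have /= -> := unsplitK (inl i : 'I_n + 'I_m)%type.
  + by have /= -> := unsplitK (inr i : 'I_n + 'I_m)%type.
- rewrite big_split_ord/=; congr (_ + _); apply: eq_bigr => i _.
  + by have /= -> := unsplitK (inl i : 'I_n + 'I_m)%type.
  + by have /= -> := unsplitK (inr i : 'I_n + 'I_m)%type.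
Qed.

Lemma combinationZ S a b x :
  combination S a x -> combination S (b * a) (b *: x).
Proof.
move=> [n [s [c [Ss <- ->]]]]; exists n, s, (fun i => b * c i); split=> //.
  by rewrite mulr_sumr.
by rewrite scaler_sumr; apply: eq_bigr => i _; rewrite scalerA.
Qed.

Definition affine_set S : Prop :=
  forall x y z t, S x -> S y -> S z -> S (x + t *: (y - z)).

Lemma affine_hull_affine S : affine_set (affine_hull S).
Proof.
move=> x y z t Sx Sy Sz; rewrite scalerBr -scaleNr.
have := combinationD Sx (combinationD (combinationZ t Sy) (combinationZ (- t) Sz)).
by rewrite !mulr1 subrr addr0.
Qed.

Lemma affine_hull_sub S : S `<=` affine_hull S.
Proof.
move=> x Sx; exists 1%N, (fun=> x), (fun=> 1).
by split=> //; rewrite big_ord1// scale1r.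
Qed.

Lemma affine_hull_min S T : affine_set T -> S `<=` T -> affine_hull S `<=` T.
Proof.
move=> Taff ST x [[|n] [s [c [Ss c1 ->]]]].
  by move: c1; rewrite big_ord0 => /esym/eqP; rewrite oner_eq0.
pose x0 := s ord0.
have -> : \sum_(i < n.+1) c i *: s i =
    \sum_(i < n.+1) c i *: (s i - x0) + x0.
  under [in RHS]eq_bigr do rewrite scalerBr.
  by rewrite sumrB -scaler_suml c1 scale1r subrK.
apply: (big_rec (fun p => T (p + x0))); first by rewrite add0r; exact/ST/Ss.
move=> i p _ Tp; rewrite -addrA [_ + (p + _)]addrC.
by apply: Taff => //; exact/ST/Ss.
Qed.

Lemma affine_direction S w : affine_set S -> S w ->
  linear_subspace [set v | S (w + v)].
Proof.
move=> Saff Sw; split; first by rewrite /= addr0.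
move=> x y a /= Sx Sy; have := Saff _ _ _ a Sy Sx Sw.
by rewrite [w + x]addrC addrK -addrA [y + _]addrC.
Qed.

Definition convex_subset S : Prop := forall x y t, 0 <= t -> t <= 1 ->
  S x -> S y -> S ((1 - t) *: x + t *: y).

Lemma convex_combE x y t : (1 - t) *: x + t *: y = x + t *: (y - x).
Proof. by rewrite scalerBl scale1r scalerBr addrAC addrA. Qed.

Lemma affine_convex S : affine_set S -> convex_subset S.
Proof. by move=> Saff x y t _ _ Sx Sy; rewrite convex_combE; exact: Saff. Qed.

(** Defined by its universal property: all uses of the hull are of the form
    that a convex condition valid on [S] is valid on the hull. *)
Definition convex_hull S : set X :=
  [set x | forall K, convex_subset K -> S `<=` K -> K x].

Lemma convex_hull_convex S : convex_subset (convex_hull S).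
Proof.
move=> x y t t0 t1 Sx Sy K cK SK.
exact: cK t0 t1 (Sx K cK SK) (Sy K cK SK).
Qed.

Lemma convex_hull_sub S : S `<=` convex_hull S.
Proof. by move=> x Sx K _; apply. Qed.

Lemma affine_hull_convex_hull S : affine_hull (convex_hull S) = affine_hull S.
Proof.
apply/seteqP; split; apply: affine_hull_min; try exact: affine_hull_affine.
  by move=> x /(_ _ (affine_convex (@affine_hull_affine S))); apply; exact: affine_hull_sub.
by move=> x Sx; apply: affine_hull_sub; exact: convex_hull_sub.
Qed.

Lemma ri_relatively_open S x : ri S x ->
  \forall y \near x, affine_hull S y -> ri S y.
Proof.
move=> [Sx nS]; have nnS := near_join nS.
near=> y => Sy; split; last by near: y.
by move: Sy; near: y.
Unshelve. all: by end_near. Qed.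

Lemma ri_absorbs S w v : ri S w -> affine_hull S (w + v) ->
  exists2 t, 0 < t & S (w + t *: v).
Proof.
move=> [Sw nS] Sv.
have Haff t : affine_hull S (w + t *: v).
  have := affine_hull_affine t (affine_hull_sub Sw) Sv (affine_hull_sub Sw).
  by rewrite [w + v]addrC addrK.
have cw : w + t *: v @[t --> 0^'+] --> w.
  have : w + t *: v @[t --> (0 : R)] --> w + 0 *: v.
    by apply: cvgD; [exact: cvg_cst|apply: cvgZr_tmp; exact: cvg_id].
  by rewrite scale0r addr0; exact: cvg_at_right_filter.
have nSt : \forall t \near 0^'+, affine_hull S (w + t *: v) -> S (w + t *: v).
  exact: cw _ nS.
have : \forall t \near 0^'+, 0 < t /\ S (w + t *: v).
  near=> t; split; first by near: t; exact: nbhs_right_gt.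
  by move: (Haff t); near: t.
by move=> /filter_ex[t [t0 St]]; exists t.
Unshelve. all: by end_near. Qed.

(** The map [h] undoes the homothety of ratio [1 - t] centred at [e], so a point
    of the affine hull near [u] lies on a segment from a point of [K] to [e]. *)
Lemma ri_segment_convex K g e t : convex_subset K -> ri K g -> K e ->
  0 <= t -> t < 1 -> ri K ((1 - t) *: g + t *: e).
Proof.
move=> cK [Kg nK] Ke t0 t1; split; first by apply: cK => //; exact: ltW.
have t10 : 1 - t != 0 by rewrite subr_eq0 gt_eqF.
set u := _ + _; pose h z := (1 - t)^-1 *: (z - t *: e).
have hu : h u = g by rewrite /h /u addrK scalerA mulVf// scale1r.
have ch : h z @[z --> u] --> g.
  rewrite -hu; apply: cvgZl_tmp; apply: cvgB; [exact: cvg_id|exact: cvg_cst].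
have nKh : \forall z \near u, affine_hull K (h z) -> K (h z) by exact: ch _ nK.
near=> z => Kz.
have hz : (1 - t) *: h z + t *: e = z by rewrite /h scalerA mulfV// scale1r subrK.
rewrite -hz; apply: cK => //; first exact: ltW.
suff : affine_hull K (h z) by near: z.
have -> : h z = z + (t / (1 - t)) *: (z - e).
  apply: (@scalerI _ _ (1 - t)) => //.
  rewrite /h scalerA mulfV// scale1r scalerDr scalerA mulrCA mulfV// mulr1.
  by rewrite scalerBr scalerBl scale1r addrA subrK.
by apply: affine_hull_affine => //; exact: affine_hull_sub.
Unshelve. all: by end_near. Qed.

(** Directions in which a segment centred at [w] stays in [K]; for convex [K]
    they form a subspace, whose growth under averaging drives the proof that
    relative interiors are nonempty. *)
Definition two_sided_directions K w : set X :=
  [set v | exists2 t, 0 < t & K (w + t *: v) /\ K (w - t *: v)].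

Lemma convex_shrink K w v t t' : convex_subset K -> K w -> K (w + t *: v) ->
  0 < t -> 0 <= t' -> t' <= t -> K (w + t' *: v).
Proof.
move=> cK Kw Kv t0 t'0 t't.
have := cK _ _ (t' / t) _ _ Kw Kv.
rewrite convex_combE (addrC w (t *: v)) addrK scalerA divfK ?gt_eqF//.
by apply; [rewrite divr_ge0// ltW|rewrite ler_pdivrMr// mul1r].
Qed.

Lemma half_convex K x y : convex_subset K -> K x -> K y ->
  K (2^-1 *: (x + y)).
Proof.
move=> cK Kx Ky; have := cK _ _ 2^-1 _ _ Kx Ky.
have -> : 1 - 2^-1 = 2^-1 :> R by field.
by rewrite -scalerDr; apply; [rewrite invr_ge0|rewrite invf_le1// ler1n].
Qed.

Lemma midpoint_refl x : 2^-1 *: (x + x) = x.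
Proof. by rewrite -{1 2}(scale1r x) -scalerDl scalerA mulVf ?scale1r// pnatr_eq0. Qed.

Lemma two_sided_subspace K w : convex_subset K -> K w ->
  linear_subspace (two_sided_directions K w).
Proof.
move=> cK Kw.
split; first by exists 1; rewrite ?scaler0 ?subr0 ?addr0.
have scal x a : two_sided_directions K w x -> two_sided_directions K w (a *: x).
  move=> [t t0 [Kp Km]]; have [->|a0] := eqVneq a 0.
    by exists 1; rewrite ?scale0r ?scaler0 ?subr0 ?addr0.
  exists (t / `|a|); first by rewrite divr_gt0// normr_gt0.
  rewrite scalerA -mulrA [_ * a]mulrC.
  have [ap|an|] := ltgtP a 0; last by move/eqP; rewrite (negbTE a0).
    by rewrite ltr0_norm// invrN mulrN mulfV// mulrN1 scaleNr opprK.
  by rewrite gtr0_norm// mulfV// mulr1.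
move=> x y a /(scal _ a) [t t0 [Kx Kx']] [s s0 [Ky Ky']].
move: (a *: x) Kx Kx' => {}x Kx Kx'.
pose m := Num.min t s.
have m0 : 0 < m by rewrite lt_min t0 s0.
have mt : m <= t by rewrite ge_min lexx.
have ms : m <= s by rewrite ge_min lexx orbT.
have mid v v' : K (w + t *: v) -> K (w + s *: v') -> K (w + (m / 2) *: (v + v')).
  move=> Kv Kv'; have := half_convex cK (convex_shrink cK Kw Kv t0 (ltW m0) mt)
    (convex_shrink cK Kw Kv' s0 (ltW m0) ms).
  by rewrite addrACA scalerDr midpoint_refl -scalerDr scalerA mulrC.
exists (m / 2); first by rewrite divr_gt0.
split; first exact: mid.
by rewrite -scalerN opprD; apply: mid; rewrite scalerN.
Qed.

Lemma two_sided_midpoint K w s : convex_subset K -> K w -> K s ->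
  let w' := 2^-1 *: (w + s) in
  two_sided_directions K w `<=` two_sided_directions K w' /\
  two_sided_directions K w' (s - w).
Proof.
move=> cK Kw Ks /=; split.
  move=> v [t t0 [Kp Km]]; exists (2^-1 * t); first by rewrite mulr_gt0.
  rewrite -scalerA -scalerDr -scalerBr; split.
    by rewrite addrAC; exact: half_convex.
  by rewrite addrAC; exact: half_convex.
exists 2^-1; first by rewrite invr_gt0.
rewrite -scalerDr -scalerBr opprB; split.
  by rewrite [w + s]addrC -addrA [w + (s - w)]addrC subrK midpoint_refl.
by rewrite -addrA [s + (w - s)]addrC subrK midpoint_refl.
Qed.

Lemma linear_subspace_sum V (I : Type) (r : seq I) (c : I -> R) (f : I -> X) :
  linear_subspace V -> (forall i, V (f i)) -> V (\sum_(i <- r) c i *: f i).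
Proof.
move=> [V0 Vlin] Vf; apply: (big_rec V) => // i x _ Vx; exact: Vlin.
Qed.

(** The halving in the induction step separates the contribution of [f i] from
    those of the other vectors. *)
Lemma two_sided_box K w (I : Type) (r : seq I) (f : I -> X) :
  convex_subset K -> K w -> (forall i, two_sided_directions K w (f i)) ->
  exists2 d : R, 0 < d & forall c : I -> R, (forall i, `|c i| <= d) ->
    K (w + \sum_(i <- r) c i *: f i).
Proof.
move=> cK Kw Kf; elim: r => [|i r [d d0 dP]].
  by exists 1 => // c _; rewrite big_nil addr0.
have [t t0 [Kp Km]] := Kf i.
exists (Num.min t d / 2); first by rewrite divr_gt0// lt_min t0.
move=> c cle; rewrite big_cons.
have c2 j : `|2 * c j| <= Num.min t d.
  by rewrite normrM ger0_norm// mulrC -ler_pdivlMr.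
have K1 : K (w + (2 * c i) *: f i).
  have := c2 i; rewrite le_min => /andP[+ _].
  case: (ger0P (2 * c i)) => c0 ct.
    exact: convex_shrink cK Kw Kp t0 c0 ct.
  rewrite -[2 * c i]opprK scaleNr -scalerN.
  by apply: convex_shrink t0 _ ct => //; rewrite ?scalerN ?oppr_ge0 ?ltW.
have K2 : K (w + \sum_(j <- r) (2 * c j) *: f j).
  by apply: dP => j; have := c2 j; rewrite le_min => /andP[].
have := half_convex cK K1 K2.
rewrite addrACA scalerDr midpoint_refl scalerDr scalerA mulrA mulVf ?pnatr_eq0// mul1r.
suff -> : 2^-1 *: \sum_(j <- r) (2 * c j) *: f j = \sum_(j <- r) c j *: f j by [].
rewrite scaler_sumr; apply: eq_bigr => j _.
by rewrite scalerA mulrA mulVf ?pnatr_eq0// mul1r.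
Qed.

End AffineGeometry.

Section RelativeInterior.
Variables (R : realType) (X : normedModType R) (dot : {dot X for idfun}).
Hypotheses (dot_norm : induces_norm dot) (Xfin : finite_dimensional X).
Implicit Types (x y z u v w g e : X) (a t : R) (S K : set X).

(** Take [w] such that the subspace of two-sided directions has maximal
    dimension, measured by orthonormal families.  If [s - w] were not in it for
    some [s] in [K], the subspace at the midpoint of [w] and [s] would be larger. *)
Lemma two_sided_maximal K w0 : convex_subset K -> K w0 ->
  exists2 w, K w & forall s, K s -> two_sided_directions K w (s - w).
Proof.
move=> cK Kw0; have [n [b bspan]] := Xfin.
suff H k : forall m (f : 'I_m -> X) w, (m + k = n)%N -> K w ->
    orthonormal_family dot f -> (forall i, two_sided_directions K w (f i)) ->
  exists2 w, K w & forall s, K s -> two_sided_directions K w (s - w).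
  by apply: (H n 0%N (fun=> 0) w0) => // -[].
elim: k => [|k IH] m f w mk Kw of_ fU;
  have [Uw|/existsNP[s /not_implyP[Ks nU]]] :=
    pselect (forall s, K s -> two_sided_directions K w (s - w));
  try by exists w.
all: have Ulin := two_sided_subspace cK Kw.
all: have [UU' U's] := two_sided_midpoint cK Kw Ks.
all: have Kw' := half_convex cK Kw Ks.
all: have U'lin := two_sided_subspace cK Kw'.
all: have nv : s - w != \sum_i dot (s - w) (f i) *: f i
  by apply/eqP => sE; apply: nU; rewrite sE; exact: linear_subspace_sum.
all: have [h [oh hU]] :=
  orthonormal_extend dot_norm of_ (fun i => UU' _ (fU i)) U's U'lin nv.
- by have := orthonormal_leq bspan oh; rewrite -mk addn0 ltnn.
- by apply: (IH _ h _ _ Kw' oh hU); rewrite addSnnS.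
Qed.

(** At a point whose two-sided directions exhaust the differences with [K], they
    contain the direction of the affine hull, and a box around the point in an
    orthonormal basis lies in [K]. *)
Lemma ri_convex_nonempty K : convex_subset K -> K !=set0 -> ri K !=set0.
Proof.
move=> cK [w0 Kw0]; have [w Kw wU] := two_sided_maximal cK Kw0.
have Ulin := two_sided_subspace cK Kw.
have [m [f [of_ fU fE]]] := orthonormal_basis dot_norm Xfin Ulin.
have [d d0 dP] := two_sided_box (index_enum 'I_m) cK Kw fU.
have affU y : affine_hull K y -> two_sided_directions K w (y - w).
  apply: (affine_hull_min (T := [set y | two_sided_directions K w (y - w)])).
    move=> x z u t /= Ux Uz Uu.
    have -> : x + t *: (z - u) - w = t *: ((-1) *: (u - w) + (z - w)) + (x - w).
      rewrite scaleN1r opprB [w - u + _]addrC [z - w + _]addrA subrK.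
      by rewrite addrAC [RHS]addrC.
    by apply: Ulin.2 => //; apply: Ulin.2.
  by move=> s Ks; exact: wU.
exists w; split=> //; apply/nbhs_ballP; exists d => //= y.
rewrite -ball_normE /= => yd Ky; rewrite -(subrK w y) addrC (fE _ (affU _ Ky)).
apply: dP => i; apply: le_trans (coord_le_norm dot_norm _ _ of_) _.
by rewrite distrC ltW.
Qed.

(** In finite dimension this is equivalent to the usual definition, that [S] lies
    between a convex set and its closure. *)
Definition nearly_convex S : Prop := ri (convex_hull S) `<=` S.

Lemma ri_nearly_convex S : nearly_convex S -> ri S = ri (convex_hull S).
Proof.
move=> ncS; apply/seteqP; split=> [x [Sx nS]|x Sx].
  split; first exact: convex_hull_sub.
  rewrite affine_hull_convex_hull; apply: filterS nS => y yS Sy.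
  by apply: convex_hull_sub; exact: yS.
split; first exact: ncS.
have := ri_relatively_open Sx; rewrite affine_hull_convex_hull.
by apply: filterS => y yS Sy; by apply: ncS; exact: yS.
Qed.

Lemma ri_nearly_convex_nonempty S : nearly_convex S -> S !=set0 -> ri S !=set0.
Proof.
move=> ncS [x Sx]; rewrite ri_nearly_convex//.
apply: ri_convex_nonempty; first exact: convex_hull_convex.
by exists x; exact: convex_hull_sub.
Qed.

Lemma ri_segment S g e t : nearly_convex S -> ri S g -> S e ->
  0 <= t -> t < 1 -> ri S ((1 - t) *: g + t *: e).
Proof.
move=> ncS; rewrite ri_nearly_convex// => Sg Se.
by apply: ri_segment_convex => //; [exact: convex_hull_convex|exact: convex_hull_sub].
Qed.

(** If every vector is a difference of points of [S1] and [S2], averaging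
    relative interior points [g1], [g2] with points having the opposite
    difference yields a common relative interior point. *)
Lemma ri_meet S1 S2 : nearly_convex S1 -> nearly_convex S2 ->
  S1 !=set0 -> S2 !=set0 -> minkowski_sub S1 S2 = setT ->
  (ri S1 `&` ri S2) !=set0.
Proof.
move=> nc1 nc2 /(ri_nearly_convex_nonempty nc1)[g1 Sg1].
move=> /(ri_nearly_convex_nonempty nc2)[g2 Sg2] S12.
have : minkowski_sub S1 S2 (g2 - g1) by rewrite S12.
move=> [s1 Ss1 [s2 Ss2 s12]].
have h0 : (0 : R) <= 2^-1 by rewrite invr_ge0.
have h1 : 2^-1 < 1 :> R by rewrite invf_lt1// ltr1n.
exists ((1 - 2^-1) *: g1 + 2^-1 *: s1); split; first exact: ri_segment.
have -> : (1 - 2^-1) *: g1 + 2^-1 *: s1 = (1 - 2^-1) *: g2 + 2^-1 *: s2.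
  have -> : 1 - 2^-1 = 2^-1 :> R by field.
  rewrite -!scalerDr; congr (_ *: _).
  by rewrite -[s1](subrK s2) s12 addrA [g1 + _]addrC subrK.
exact: ri_segment.
Qed.

(** Moving from a common relative interior point towards a point of the
    intersection stays in both relative interiors, so the closure and the affine
    hull of the intersection are those of the smaller set; moving beyond a
    relative interior point of the intersection shows that it lies in both. *)
Section Sandwich.
Variables S1 S2 T : set X.
Hypotheses (nc1 : nearly_convex S1) (nc2 : nearly_convex S2).
Hypothesis meet12 : (ri S1 `&` ri S2) !=set0.
Hypotheses (GT : ri S1 `&` ri S2 `<=` T) (TE : T `<=` S1 `&` S2).

Let segment g e t : (ri S1 `&` ri S2) g -> (S1 `&` S2) e ->
  0 <= t -> t < 1 -> (ri S1 `&` ri S2) ((1 - t) *: g + t *: e).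
Proof. by move=> [g1 g2] [e1 e2] t0 t1; split; exact: ri_segment. Qed.

Let affE : affine_hull (S1 `&` S2) = affine_hull T.
Proof.
apply/seteqP; split; apply: affine_hull_min; try exact: affine_hull_affine.
  move=> e Ee; have [g Gg] := meet12.
  have h1 : 2^-1 < 1 :> R by rewrite invf_lt1// ltr1n.
  have h0 : (0 : R) <= 2^-1 by rewrite invr_ge0.
  have gT := affine_hull_sub (GT Gg).
  have mT := affine_hull_sub (GT (segment Gg Ee h0 h1)).
  have := affine_hull_affine 2 gT mT gT.
  by rewrite convex_combE addrAC subrr add0r scalerA mulfV ?pnatr_eq0// scale1r addrC subrK.
by move=> x /TE; exact: affine_hull_sub.
Qed.

Lemma ri_meet_sub : ri (S1 `&` S2) `<=` ri S1 `&` ri S2.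
Proof.
move=> x xE; have [g Gg] := meet12.
have Eg := TE (GT Gg).
have [t t0 Et] : exists2 t, 0 < t & (S1 `&` S2) (x + t *: (x - g)).
  apply: ri_absorbs => //.
  have := affine_hull_affine 1 (affine_hull_sub xE.1) (affine_hull_sub xE.1) (affine_hull_sub Eg).
  by rewrite scale1r.
have t1 : 0 < 1 + t by rewrite ltr_wpDl.
have := segment Gg Et (t := (1 + t)^-1).
rewrite invr_ge0 ltW// invf_lt1// ltrDl => /(_ isT t0).
rewrite convex_combE.
have -> : x + t *: (x - g) - g = (1 + t) *: (x - g).
  by rewrite scalerDl scale1r addrAC.
by rewrite scalerA mulVf ?gt_eqF// scale1r addrC subrK.
Qed.

Lemma near_equal_sandwich : near_equal T (S1 `&` S2).
Proof.
split.
  apply/seteqP; split; first exact: closure_subset.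
  suff : S1 `&` S2 `<=` closure T.
    by move=> ET x xE; apply: closed_closure; exact: closure_subset ET x xE.
  move=> e Ee B eB; have [g Gg] := meet12.
  have cg : (1 - (1 - t)) *: g + (1 - t) *: e @[t --> (0 : R)^'+] --> e.
    have : (1 - (1 - t)) *: g + (1 - t) *: e @[t --> (0 : R)] -->
        (1 - (1 - 0)) *: g + (1 - 0) *: e.
      have c1 : 1 - t @[t --> (0 : R)] --> 1 - (0 : R).
        by apply: cvgB; [exact: cvg_cst|exact: cvg_id].
      by apply: cvgD; apply: cvgZr_tmp => //; apply: cvgB => //; exact: cvg_cst.
    by rewrite subr0 subrr scale0r add0r scale1r; exact: cvg_at_right_filter.
  have nB : \forall t \near (0 : R)^'+, B ((1 - (1 - t)) *: g + (1 - t) *: e).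
    exact: cg _ eB.
  have : \forall t \near (0 : R)^'+, T ((1 - (1 - t)) *: g + (1 - t) *: e) /\
      B ((1 - (1 - t)) *: g + (1 - t) *: e).
    near=> t; split; last by near: t.
    apply: GT; apply: segment => //.
      by rewrite subr_ge0; near: t; exact: nbhs_right_le.
    by rewrite ltrBlDr ltrDl; near: t; exact: nbhs_right_gt.
  by move=> /filter_ex[t [Tt Bt]]; exists ((1 - (1 - t)) *: g + (1 - t) *: e).
apply/seteqP; split=> x.
  move=> [Tx nT]; split; first exact: TE.
  by rewrite affE; apply: filterS nT => y yT /yT/TE.
move=> xE; split; first exact/GT/ri_meet_sub.
have := ri_relatively_open xE; rewrite affE.
by apply: filterS => y yE /yE/ri_meet_sub/GT.
Unshelve. all: by end_near. Qed.

End Sandwich.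

End RelativeInterior.

(** * Near convexity of differences of domains *)

Section DomainsAndRanges.
Variables (R : realType) (X : normedModType R) (dot : {dot X for idfun}).
Hypotheses (dot_norm : induces_norm dot) (Xfin : finite_dimensional X).
Implicit Types (x y z u v w p q : X) (a t l : R) (A B C : X -> set X).

Lemma affine_hull_direction S w : affine_hull S w ->
  linear_subspace [set v | affine_hull S (w + v)].
Proof. exact/affine_direction/affine_hull_affine. Qed.

(** The dual regularization of the problem of writing [w] as a difference of
    domain points is [l *: z + J_C z - J_A (- z) = - w].  A pair of graph points
    bounds its solutions in the direction of the corresponding difference, and
    such bounds survive convex combinations. *)
Lemma nearly_convex_dom_sub A C :
  maximally_monotone dot A -> maximally_monotone dot C ->
  nearly_convex (minkowski_sub (dom A) (dom C)).
Proof.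
move=> Amax Cmax w wri; set D := minkowski_sub _ _ in wri *.
pose F z := resolvent C z - resolvent A (- z).
have cF : continuous F.
  move=> z; apply: cvgB; first exact: (resolvent_continuous dot_norm Xfin Cmax).
  apply: (@cvg_comp _ _ _ (fun z : X => - z) (resolvent A) _ (nbhs (- z))).
    by apply: cvgN; exact: cvg_id.
  exact: (resolvent_continuous dot_norm Xfin Amax).
have mF : monotone_map dot F.
  move=> x y; have := resolvent_firm dot_norm Xfin x y Cmax.
  have := resolvent_firm dot_norm Xfin (- x) (- y) Amax.
  have := dot_ge0 dot_norm (resolvent A (- x) - resolvent A (- y)).
  have := dot_ge0 dot_norm (resolvent C x - resolvent C y).
  rewrite /F; move: (resolvent A (- x)) (resolvent A (- y)) => a a'.
  move: (resolvent C x) (resolvent C y) => c c'.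
  have -> : c - a - (c' - a') = c - c' - (a - a') by rewrite !opprD !opprK addrACA.
  have -> : - x - - y = - (x - y) by rewrite opprD opprK.
  move: (x - y) (c - c') (a - a') => d e f.
  rewrite !dotE (dotC _ e d) (dotC _ f d); lra.
have solE l z : l *: z + F z = - w ->
    resolvent A (- z) - resolvent C z = w + l *: z.
  move=> E; rewrite -[LHS]opprB -/(F z).
  have -> : F z = - w - l *: z by rewrite -E [l *: z + _]addrC addrK.
  by rewrite opprD !opprK.
have DJ z : D (resolvent A (- z) - resolvent C z).
  exists (resolvent A (- z)).
    by exists (- z - resolvent A (- z)); exact: (resolventP dot_norm Xfin).
  exists (resolvent C z) => //.
  by exists (z - resolvent C z); exact: (resolventP dot_norm Xfin).
have affw : affine_hull (convex_hull D) w by exact: affine_hull_sub wri.1.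
have Vlin := affine_hull_direction affw.
pose Q := [set y | exists K, forall l z, 0 < l -> l *: z + F z = - w ->
  - K <= dot (y - w) z].
have convQ : convex_subset Q.
  move=> x y t t0 t1 [K KP] [K' KP'].
  exists ((1 - t) * K + t * K') => l z l0 zE.
  have -> : (1 - t) *: x + t *: y - w = (1 - t) *: (x - w) + t *: (y - w).
    rewrite !scalerBr addrACA -opprD -scalerDl subrK scale1r; congr (_ - _).
  have := ler_wpM2l t0 (KP' _ _ l0 zE).
  have t1' : 0 <= 1 - t by rewrite subr_ge0.
  by have := ler_wpM2l t1' (KP _ _ l0 zE); rewrite !dotE; lra.
have DQ : D `<=` Q.
  move=> _ [p [p' App] [q [q' Cqq] <-]].
  (* the bound comes from the monotonicity inequalities at (p, p') and (q, q'),
     with the terms linear in the resolvents absorbed by Young's inequality *)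
  exists (dot (p - p') (p - p') + dot p p' + dot (q - q') (q - q') + dot q q').
  move=> l z l0 zE.
  have := Amax.1 _ _ _ _ (resolventP dot_norm Xfin (- z) Amax) App.
  have := Cmax.1 _ _ _ _ (resolventP dot_norm Xfin z Cmax) Cqq.
  have := solE _ _ zE.
  move: (resolvent A _) (resolvent C _) => a c ac.
  have := dot_young dot_norm a (p - p'); have := dot_young dot_norm c (q - q').
  have /(congr1 (dot^~ z)) : a - c = w + l *: z by [].
  have := mulr_ge0 (ltW l0) (dot_ge0 dot_norm z).
  rewrite !dotE !(dotC _ p' p) !(dotC _ q' q) (dotC _ p a) (dotC _ q c).
  lra.
suff [z zE] : exists z, F z = - w.
  by move: (DJ z); have := solE 0 z; rewrite !scale0r add0r addr0 => ->.
apply: (solution_of_bounded_regularization dot_norm Xfin cF mF Vlin).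
  move=> l z l0 _ zE.
  have VJ : affine_hull (convex_hull D) (w + l *: z).
    by rewrite -(solE _ _ zE); apply: affine_hull_sub; apply: convex_hull_sub; exact: DJ.
  have := Vlin.2 (l *: z) 0 l^-1.
  by rewrite /= !addr0 scalerA mulVf ?gt_eqF// scale1r; apply.
move=> v Vv.
have V'v : affine_hull (convex_hull D) (w + - v).
  by rewrite -scaleN1r -[_ *: v]addr0; apply: Vlin.2 => //; exact: Vlin.1.
have [t t0 Dt] := ri_absorbs wri V'v.
have [K KP] : Q (w + t *: - v) by exact: Dt.
exists (K / t) => l z l0 l1 zE; rewrite ler_pdivlMr//.
have := KP _ _ l0 zE; rewrite [w + _]addrC addrK !dotE (dotC _ v z); lra.
Qed.

Lemma nearly_convex_dom_sub_ran A B :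
  maximally_monotone dot A -> maximally_monotone dot B ->
  nearly_convex (minkowski_sub (dom A) (ran B)).
Proof.
by move=> Amax Bmax; exact: nearly_convex_dom_sub Amax (maximally_monotone_inv Bmax).
Qed.

Lemma nearly_convex_ran_add_dom A B :
  maximally_monotone dot A -> maximally_monotone dot B ->
  nearly_convex (minkowski_add (ran A) (dom B)).
Proof.
move=> Amax Bmax.
have -> : minkowski_add (ran A) (dom B) = minkowski_sub (dom (op_inv A))
    (dom (fun x => [set u | B (- x) (- u)])).
  apply/seteqP; split=> _ [u Au [x [v Bxv] <-]]; exists u => //; exists (- x).
  - by exists (- v); rewrite /= !opprK.
  - by rewrite opprK.
  - by exists (- v).
  - by [].
apply: nearly_convex_dom_sub; first exact: maximally_monotone_inv.
exact: maximally_monotone_opp.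
Qed.

(** Minty's theorem for [B] makes every vector of the form
    (a - b') - (a' + b) with a prescribed graph point (a, a') of [A]. *)
Lemma sub_dom_ran_total A B :
  maximally_monotone dot A -> maximally_monotone dot B ->
  minkowski_sub (minkowski_sub (dom A) (ran B)) (minkowski_add (ran A) (dom B))
    = setT.
Proof.
move=> Amax Bmax; apply/seteqP; split=> // x _.
have [a [a' Aaa]] := gra_nonempty dot_norm Xfin Amax.
have [b Bb] := minty dot_norm Xfin (a - a' - x) Bmax.
set b' := a - a' - x - b in Bb.
exists (a - b'); first by exists a; [exists a'|exists b'; [exists b|]].
exists (a' + b); first by exists a'; [exists a|exists b; [exists b'|]].
rewrite /b' !opprD !opprK !addrA subrr add0r.
by rewrite [_ - a']addrC !addrA addNr add0r addrK.
Qed.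

Lemma ri_dom_ran_meet A B :
  maximally_monotone dot A -> maximally_monotone dot B ->
  (ri (minkowski_sub (dom A) (ran B)) `&`
   ri (minkowski_add (ran A) (dom B))) !=set0.
Proof.
move=> Amax Bmax.
have [a [a' Aaa]] := gra_nonempty dot_norm Xfin Amax.
have [b [b' Bbb]] := gra_nonempty dot_norm Xfin Bmax.
apply: (ri_meet dot_norm Xfin).
- exact: nearly_convex_dom_sub_ran.
- exact: nearly_convex_ran_add_dom.
- by exists (a - b'), a; [exists a'|exists b'; [exists b|]].
- by exists (a' + b), a'; [exists a|exists b; [exists b'|]].
- exact: sub_dom_ran_total.
Qed.

End DomainsAndRanges.

(** * The range of the Douglas--Rachford operator *)

Section DouglasRachford.
Variables (R : realType) (X : normedModType R) (dot : {dot X for idfun}).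
Hypotheses (dot_norm : induces_norm dot) (Xfin : finite_dimensional X).
Variables (A B : X -> set X).
Hypotheses (Amax : maximally_monotone dot A) (Bmax : maximally_monotone dot B).
Implicit Types (x y z u v w a b p q : X) (t l : R).

Local Notation T := (douglas_rachford A B).
Local Notation D' := (minkowski_sub (dom A) (ran B)).
Local Notation R' := (minkowski_add (ran A) (dom B)).

Lemma douglas_rachfordE x :
  T x = x - resolvent A x + resolvent B (reflected_resolvent A x).
Proof.
rewrite /douglas_rachford {1}/reflected_resolvent.
move: (resolvent B _) => b; rewrite /reflected_resolvent -scalerDr opprB.
rewrite [2 *: b + _]addrC addrA [x + (x - _)]addrA.
rewrite scalerDr scalerBr !scalerA mulVf ?pnatr_eq0// !scale1r midpoint_refl.
by [].
Qed.

Lemma douglas_rachford_graph x : exists a a' b b',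
  [/\ A a a', B b b', x = a + a', T x = a - b' & T x = a' + b].
Proof.
pose a := resolvent A x; pose b := resolvent B (reflected_resolvent A x).
exists a, (x - a), b, (reflected_resolvent A x - b); split.
- exact: (resolventP dot_norm Xfin).
- exact: (resolventP dot_norm Xfin).
- by rewrite addrC subrK.
- rewrite douglas_rachfordE -/a -/b /reflected_resolvent -/a.
  rewrite scaler_nat mulr2n !opprB opprD [RHS]addrC !addrA subrK.
  by rewrite [LHS]addrC addrA.
- by rewrite douglas_rachfordE.
Qed.

Lemma douglas_rachford_eq a a' b b' : A a a' -> B b b' -> a - b' = a' + b ->
  T (a + a') = a' + b.
Proof.
move=> Aaa Bbb E; rewrite douglas_rachfordE /reflected_resolvent.
have -> : resolvent A (a + a') = a.
  by apply: (resolvent_unique dot_norm Xfin Amax); rewrite [a + a']addrC addrK.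
rewrite [a + a']addrC addrK; congr (_ + _).
apply: (resolvent_unique dot_norm Xfin Bmax).
suff -> : 2 *: a - (a' + a) - b = b' by [].
rewrite scaler_nat mulr2n [a' + a]addrC opprD addrACA subrr add0r.
by rewrite -addrA -opprD -E opprB addrC subrK.
Qed.

Lemma range_douglas_rachford_sub : range T `<=` D' `&` R'.
Proof.
move=> _ [x _ <-]; have [a [a' [b [b' [Aaa Bbb _ Tx Tx']]]]] := douglas_rachford_graph x.
split; first by rewrite Tx; exists a; [exists a'|exists b'; [exists b|]].
by rewrite Tx'; exists a'; [exists a|exists b; [exists b'|]].
Qed.

(** Setting [b' = a - w], a point [b] of [B^-1 (a - w)] with [a' + b = w] makes
    [(b, b')] a graph point of [B] with [a - b' = w = a' + b]. *)
Lemma range_douglas_rachford_ran_sum w :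
  ran (op_add A (op_shift (op_inv B) w)) w -> range T w.
Proof.
move=> [a [a' Aaa [b Bb E]]]; exists (a + a') => //.
rewrite -E; apply: (douglas_rachford_eq (b' := a - w)) => //.
by rewrite E opprB addrC subrK.
Qed.

Lemma douglas_rachford_continuous : continuous T.
Proof.
have cR C : maximally_monotone dot C -> continuous (reflected_resolvent C).
  move=> Cmax x; apply: cvgB; last exact: cvg_id.
  by apply: cvgZl_tmp; exact: (resolvent_continuous dot_norm Xfin Cmax).
move=> x; apply: cvgD; first by apply: cvgZl_tmp; exact: cvg_id.
apply: cvgZl_tmp.
apply: (@cvg_comp _ _ _ (reflected_resolvent A) (reflected_resolvent B) _
  (nbhs (reflected_resolvent A x))); exact: cR.
Qed.

(** With [a - b' = a' + b] equal to the value of the operator, the product of the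
    differences of values and arguments is the squared norm of the first plus the
    monotonicity products of [A] and [B]. *)
Lemma douglas_rachford_monotone : monotone_map dot T.
Proof.
move=> x y.
have [a [a' [b [b' [Aaa Bbb xE Tx Tx']]]]] := douglas_rachford_graph x.
have [c [c' [d [d' [Acc Bdd yE Ty Ty']]]]] := douglas_rachford_graph y.
have := Amax.1 _ _ _ _ Aaa Acc; have := Bmax.1 _ _ _ _ Bbb Bdd.
have e1 : T x - T y = (a - c) - (b' - d').
  by rewrite Tx Ty !opprD !opprK addrACA.
have e2 : T x - T y = (a' - c') + (b - d).
  by rewrite Tx' Ty' opprD addrACA.
have -> : x - y = (a - c) + (a' - c') by rewrite xE yE opprD addrACA.
have ea : a - c = (T x - T y) + (b' - d') by rewrite e1 subrK.
have ea' : a' - c' = (T x - T y) - (b - d) by rewrite e2 addrK.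
rewrite ea ea'; have := dot_ge0 dot_norm (T x - T y).
move: (T x - T y) (b - d) (b' - d') => t e e'.
rewrite !dotE (dotC _ e' t) (dotC _ e' e) (dotC _ e t); lra.
Qed.

Section Target.
Variable w : X.

(** The solutions of [l *: x + T x = w] enter through their splitting [x = a + a']:
    near a relative interior point, bounds are available for [a] and [a']
    separately, and the pairs of directions of such bounds form a convex cone. *)
Definition controlled y1 y2 : Prop :=
  exists K, forall l a a' b b', 0 < l -> l <= 1 -> A a a' -> B b b' ->
    l *: (a + a') + (a - b') = w -> l *: (a + a') + (a' + b) = w ->
    dot a' y1 + dot a y2 <= K.

Lemma controlledD y1 y2 z1 z2 :
  controlled y1 y2 -> controlled z1 z2 -> controlled (y1 + z1) (y2 + z2).
Proof.
move=> [K KP] [K' KP']; exists (K + K') => l a a' b b' l0 l1 Aaa Bbb E1 E2.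
have := KP _ _ _ _ _ l0 l1 Aaa Bbb E1 E2; have := KP' _ _ _ _ _ l0 l1 Aaa Bbb E1 E2.
rewrite !dotE; lra.
Qed.

Lemma controlledZ t y1 y2 : 0 < t ->
  controlled (t *: y1) (t *: y2) -> controlled y1 y2.
Proof.
move=> t0 [K KP]; exists (K / t) => l a a' b b' l0 l1 Aaa Bbb E1 E2.
rewrite ler_pdivlMr//; have := KP _ _ _ _ _ l0 l1 Aaa Bbb E1 E2.
rewrite !dotE; lra.
Qed.

(** Expanding the two monotonicity products at a solution, the terms in the
    regularization parameter have a favourable sign up to a bounded error. *)
Lemma controlled_of_bound p p' q q' (M : R) :
  (forall a a' b b', A a a' -> B b b' ->
     - M <= dot (a - p) (a' - p') + dot (b - q) (b' - q')) ->
  controlled (p - q' - w) (p' + q - w).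
Proof.
move=> bnd; set y1 := p - q' - w; set y2 := p' + q - w.
(* k collects the terms of order l: l <x, k> - l |x|^2 <= |k|^2 for l <= 1 *)
pose k := p + p' - y1 - y2.
exists (M + dot p' y1 + dot p y2 - dot y1 y2 + dot k k).
move=> l a a' b b' l0 l1 Aaa Bbb E1 E2; have := bnd _ _ _ _ Aaa Bbb.
pose s := l *: (a + a').
have -> : b - q = - (a' - p' + s + y2).
  rewrite /y2 -E2 -/s (addrAC a') [_ + (p' + q - _)]addrA [_ - p' + _]addrA subrK.
  rewrite [s + _]addrA [s + a']addrC [a' + s + q]addrC.
  by rewrite [- (a' + s + b)]opprD [_ + (- (a' + s) - b)]addrA addrK opprB.
have -> : b' - q' = a - p + s + y1.
  rewrite /y1 -E1 -/s (addrAC a) [RHS]addrA [_ - p + _]addrA subrK.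
  by rewrite [s + _]addrA [s + a]addrC opprB [RHS]addrC addrA subrK.
have young := dot_young dot_norm (a + a') k.
have lk : l * dot k k <= dot k k by rewrite ler_piMl// dot_ge0.
have lyoung : l * (dot (a + a') k - dot (a + a') (a + a')) <= l * dot k k.
  by rewrite ler_pM2l.
have ll : 0 <= l * (l * dot (a + a') (a + a')).
  by rewrite !mulr_ge0 ?(dot_ge0 dot_norm)// ltW.
suff -> : dot (a - p) (a' - p') + dot (- (a' - p' + s + y2)) (a - p + s + y1) =
    l * (dot (a + a') k - dot (a + a') (a + a')) - l * (l * dot (a + a') (a + a'))
    - (dot a' y1 + dot a y2) + dot p' y1 + dot p y2 - dot y1 y2.
  lra.
clear; rewrite /s /k; clearbody y1 y2; rewrite !dotE.
rewrite ?(dotC _ a' a) ?(dotC _ p a) ?(dotC _ p' a) ?(dotC _ y1 a) ?(dotC _ y2 a) ?(dotC _ p a') ?(dotC _ p' a') ?(dotC _ y1 a')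
  ?(dotC _ y2 a') ?(dotC _ p' p) ?(dotC _ y1 p) ?(dotC _ y2 p) ?(dotC _ y1 p') ?(dotC _ y2 p') ?(dotC _ y2 y1).
ring.
Qed.

(** Graph points of [A] and [B] control pairs whose second component is one of
    the directions controlled by hypothesis; subtracting it controls each
    direction of [D'] separately.  Solutions lie in the common directions of [D']
    and [R'], where both kinds of control add up to a bound. *)
Lemma range_douglas_rachford_of_controlled : (ri D' `&` ri R') w ->
  (forall p' q, ran A p' -> dom B q -> controlled 0 (p' + q - w)) ->
  range T w.
Proof.
move=> [wD wR] ctrl.
have Vlin1 := affine_hull_direction (affine_hull_sub wD.1).
have Vlin2 := affine_hull_direction (affine_hull_sub wR.1).
pose V := [set v | affine_hull D' (w + v)] `&` [set v | affine_hull R' (w + v)].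
have Vlin : linear_subspace V.
  split; first by split; [exact: Vlin1.1|exact: Vlin2.1].
  by move=> x y t [x1 x2] [y1 y2]; split; [exact: Vlin1.2|exact: Vlin2.2].
have ctrl2 v : affine_hull R' (w + v) -> controlled 0 v.
  move=> /(ri_absorbs wR)[t t0 [p' Ap' [q Bq E]]].
  apply: (controlledZ t0); rewrite scaler0.
  have -> : t *: v = p' + q - w by rewrite E addrC addKr.
  exact: ctrl.
have ctrl1 v : affine_hull D' (w + v) -> controlled v 0.
  move=> /(ri_absorbs wD)[t t0 [p [p' App] [q' [q Bqq] E]]].
  have Rpq : R' (p' + q) by exists p'; [exists p|exists q; [exists q'|]].
  have c1 : controlled (p - q' - w) (p' + q - w).
    apply: (@controlled_of_bound _ _ _ _ 0) => a a' b b' Aaa Bbb.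
    by rewrite oppr0 addr_ge0 ?(Amax.1 _ _ _ _ Aaa App) ?(Bmax.1 _ _ _ _ Bbb Bqq).
  have c2 : controlled 0 (- (p' + q - w)).
    apply: ctrl2; rewrite -scaleN1r -[_ *: _]addr0; apply: Vlin2.2; last exact: Vlin2.1.
    by rewrite /= addrC subrK; exact: affine_hull_sub.
  apply: (controlledZ t0); rewrite scaler0.
  have := controlledD c1 c2; rewrite addr0 subrr.
  by have -> : p - q' - w = t *: v by rewrite E addrC addKr.
have solV (W : set X) l z : affine_hull W (T z) ->
    linear_subspace [set v | affine_hull W (w + v)] -> 0 < l -> l *: z + T z = w ->
    affine_hull W (w + z).
  move=> WT [W0 Wlin] l0 E; have := Wlin (- (l *: z)) 0 (- l^-1) _ W0.
  rewrite /= addr0 scalerN scaleNr opprK scalerA mulVf ?gt_eqF// scale1r; apply.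
  by rewrite -{1}E [_ + T z]addrC addrK.
have [x Tx] : exists x, T x = w; last by exists x.
apply: (solution_of_bounded_regularization dot_norm Xfin
  douglas_rachford_continuous douglas_rachford_monotone Vlin).
  move=> l z l0 _ E; have [Dz Rz] : (D' `&` R') (T z).
    by apply: range_douglas_rachford_sub; exists z.
  by split; apply: (solV _ l) => //; exact: affine_hull_sub.
move=> v [v1 v2]; have := controlledD (ctrl1 v v1) (ctrl2 v v2).
rewrite addr0 add0r => -[K KP]; exists K => l z l0 l1 E.
have [a [a' [b [b' [Aaa Bbb zE Tz Tz']]]]] := douglas_rachford_graph z.
rewrite zE dotDl addrC; apply: (KP l a a' b b') => //.
  by rewrite -Tz -zE.
by rewrite -Tz' -zE.
Qed.

End Target.

Lemma rectangular_bound C x v : rectangular dot C -> dom C x -> ran C v ->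
  exists M, forall z z', C z z' -> - M <= dot (z - x) (z' - v).
Proof.
move=> [_ recC] Cx Cv; have := recC x v Cx Cv.
set E := [set _ | _ in _]; have Ele := @ereal_inf_lbound R E.
have Emem z z' : C z z' -> (ereal_inf E <= (dot (z - x) (z' - v))%:E)%E.
  move=> Czz; apply: Ele; exists (z, z') => //=.
  by rewrite -(opprB x) -(opprB v) dotNl dotNr opprK.
case: (ereal_inf E) Emem => [r||] // Emem _.
  by exists (- r) => z z' /Emem; rewrite lee_fin opprK.
by exists 0 => z z' /Emem; rewrite leye_eq.
Qed.

(** Rectangularity allows [p, p'] and [q, q'] to be chosen independently, so the
    first component can be made 0 by writing [w] as [p - q']. *)
Lemma ri_sub_range_rectangular : rectangular dot A -> rectangular dot B ->
  ri D' `&` ri R' `<=` range T.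
Proof.
move=> recA recB w wri; apply: range_douglas_rachford_of_controlled => // p' q Ap' Bq.
have [[p Ap [q' Bq' E]] _] := wri.1.
have -> : 0 = p - q' - w by rewrite E subrr.
have [M MP] := rectangular_bound recA Ap Ap'.
have [N NP] := rectangular_bound recB Bq Bq'.
apply: (@controlled_of_bound _ _ _ _ _ (M + N)) => a a' b b' /MP ? /NP ?.
by rewrite opprD lerD.
Qed.

(** The first component is made 0 by taking [p := q' + w], which lies in the domain
    of [A], so [(q, q')] can be kept in the graph of [B]. *)
Lemma ri_sub_range_ran_sub_dom : rectangular dot A ->
  minkowski_add (ran B) (ri D' `&` ri R') `<=` dom A ->
  ri D' `&` ri R' `<=` range T.
Proof.
move=> recA BA w wri; apply: range_douglas_rachford_of_controlled => // p' q Ap' [q' Bqq].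
have Ap : dom A (q' + w) by apply: BA; exists q'; [exists q|exists w].
have -> : 0 = (q' + w) - q' - w by rewrite addrAC addrK subrr.
have [M MP] := rectangular_bound recA Ap Ap'.
apply: (@controlled_of_bound _ _ _ _ _ M) => a a' b b' /MP ? Bbb.
by rewrite -[leLHS]addr0 lerD// (Bmax.1 _ _ _ _ Bbb Bqq).
Qed.

Lemma dom_sub_ran_full C : C = A \/ C = op_inv B -> dom C = setT -> D' = setT.
Proof.
move=> CAB domC; apply/seteqP; split=> // x _; case: CAB domC => -> domC.
  have [b [b' Bbb]] := gra_nonempty dot_norm Xfin Bmax.
  by exists (x + b'); [rewrite domC|exists b'; [exists b|rewrite addrK]].
have [a [a' Aaa]] := gra_nonempty dot_norm Xfin Amax.
exists a; first by exists a'.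
exists (a - x); last by rewrite opprB addrC subrK.
by have : dom (op_inv B) (a - x) by rewrite domC.
Qed.

End DouglasRachford.

Theorem corollary5p3 (R : realType) (X : normedModType R)
    (dot : {dot X for idfun})
    (Xfin : finite_dimensional X) (dot_norm : induces_norm dot)
    (A B : X -> set X)
    (Amax : maximally_monotone dot A) (Bmax : maximally_monotone dot B) :
  let D' := minkowski_sub (dom A) (ran B) in
  let R' := minkowski_add (ran A) (dom B) in
  let T := douglas_rachford A B in
  (forall w : X, (ri D' `&` ri R') w ->
     ri (minkowski_add (ran A) (dom B)) `<=`
       ri (ran (op_add A (op_shift (op_inv B) w))))
  \/ (rectangular dot A /\ rectangular dot B)
  \/ (minkowski_add (ran B) (ri D' `&` ri R') `<=` dom A /\ rectangular dot A) ->
  near_equal (range T)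
    (minkowski_sub (dom A) (ran B) `&` minkowski_add (ran A) (dom B))
  /\ ((exists C : X -> set X,
         [/\ C = A \/ C = op_inv B, dom C = setT & rectangular dot C]) ->
      near_equal (range T) (minkowski_add (ran A) (dom B)))
  /\ (ri (D' `&` R') = D' `&` R' ->
      range T =
        minkowski_sub (dom A) (ran B) `&` minkowski_add (ran A) (dom B)).
Proof.
move=> D' R' T cases.
have ncD := nearly_convex_dom_sub_ran dot_norm Xfin Amax Bmax.
have ncR := nearly_convex_ran_add_dom dot_norm Xfin Amax Bmax.
have meet := ri_dom_ran_meet dot_norm Xfin Amax Bmax.
have TE := range_douglas_rachford_sub dot_norm Xfin Amax Bmax.
have GT : ri D' `&` ri R' `<=` range T.
  case: cases => [sumri|[[recA recB]|[BA recA]]].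
  - move=> w wri; apply: (range_douglas_rachford_ran_sum dot_norm Xfin Amax Bmax).
    exact: (sumri w wri w wri.2).1.
  - exact: (ri_sub_range_rectangular dot_norm Xfin Amax Bmax).
  - exact: (ri_sub_range_ran_sub_dom dot_norm Xfin Amax Bmax).
have nearT := near_equal_sandwich ncD ncR meet GT TE.
split=> //; split.
  move=> [C [CAB domC _]]; move: nearT.
  by rewrite (dom_sub_ran_full dot_norm Xfin Amax Bmax CAB domC) setTI.
move=> riE; apply/seteqP; split=> // w; rewrite -[X in X w]riE.
by move=> /(ri_meet_sub ncD ncR meet GT TE)/GT.
Qed.
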